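(* Let $H$ and $\Gamma$ be Hermitian operators on a finite-dimensional Hilbert space, let $\mathcal L_H\sigma=-i[H,\sigma]$ and $\mathcal L_\Gamma\sigma=-\{\Gamma,\sigma\}$, and let $\rho(s)$, $s\geq 0$, be the solution of the evolution equation with non-Hermitian Hamiltonian $J=H-i\Gamma$, $$\frac{d\rho}{ds}=-i[H,\rho]-\{\Gamma,\rho\}=(\mathcal L_H+\mathcal L_\Gamma)\rho ,$$ with $\rho(0)$ a density operator, and suppose $\|\rho(s)\|_1\le1$ for all $s\ge0$. Let $\tilde\rho_0(t)=e^{t\mathcal L_H}\rho(0)$ be the zeroth-order truncation of the perturbative expansion in $\mathcal L_\Gamma$. Then $\|\mathcal L_\Gamma\|_{1\to1}\le2\|\Gamma\|_\infty$, and for every $t\ge0$, $$D_1(\rho(t),\tilde\rho_0(t))\le\|\Gamma\|_\infty\,t .$$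
   Context: $\|A\|_1$ is the trace norm (sum of singular values), $\|A\|_\infty$ the operator norm (largest singular value), $D_1(\rho_1,\rho_2)=\tfrac12\|\rho_1-\rho_2\|_1$, and for a superoperator $\mathcal A$, $\|\mathcal A\|_{1\to1}=\sup_{\sigma\ne0}\|\mathcal A\sigma\|_1/\|\sigma\|_1$. Here $e^{t\mathcal L_H}\sigma=e^{-iHt}\sigma e^{iHt}$. *)

(* Defs.v *)
From HB Require Import structures.
From mathcomp Require Import all_boot all_order all_algebra.
From mathcomp Require Import all_classical all_reals all_analysis.
From mathcomp Require Import complex.
Set Implicit Arguments.
Unset Strict Implicit.
Unset Printing Implicit Defensive.
Import Order.TTheory GRing.Theory Num.Theory.
Import numFieldTopology.Exports numFieldNormedType.Exports.
Local Open Scope classical_set_scope.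
Local Open Scope ring_scope.
Local Open Scope complex_scope.
Local Open Scope sesquilinear_scope.

(* R[i] carries the topology and norm given by the complex modulus, which every
   abstract numClosedFieldType already has but the concrete type lacks. *)
HB.instance Definition _ (R : realType) := PseudoPointedMetric.copy R[i] R[i]^o.
HB.instance Definition _ (R : realType) := NormedModule.copy R[i] R[i]^o.

(* Operators on an n-dimensional complex Hilbert space are represented by their
   matrices in an orthonormal basis, and superoperators by maps from matrices
   to matrices. *)

Section TraceNorms.
Variables (R : realType) (n : nat).
Implicit Types A B : 'M[R[i]]_n.

(* The spectrum (with multiplicity) of the positive semidefinite matrix A^* A
   consists of nonnegative reals, so taking real parts loses nothing. *)
Definition singular_value A (j : 'I_n) : R :=
  Num.sqrt (complex.Re (spectral_diag (A ^t* *m A) 0 j)).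

Definition trace_norm A : R := \sum_j singular_value A j.

Definition operator_norm A : R := \big[Num.max/0]_j singular_value A j.

Definition trace_distance A B : R := 2^-1 * trace_norm (A - B).

(* The supremum is taken in the extended reals, so that an unbounded map would
   have norm +oo. *)
Definition norm_1to1 (L : 'M[R[i]]_n -> 'M[R[i]]_n) : \bar R :=
  ereal_sup [set (trace_norm (L S) / trace_norm S)%:E | S in [set S | S != 0]].

Definition is_density A : Prop :=
  [/\ A \is hermsymmx,
      forall v : 'cV[R[i]]_n, 0 <= (v ^t* *m A *m v) 0 0
    & \tr A = 1].

End TraceNorms.

Section Evolution.
Variables (R : realType) (n : nat).
Implicit Types H G S : 'M[R[i]]_n.

Definition commutator H S := H *m S - S *m H.
Definition anticommutator G S := G *m S + S *m G.

Definition liouvillian_H H S := - 'i *: commutator H S.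
Definition liouvillian_G G S := - anticommutator G S.

(* [rho] is only meaningful on [0, +oo[: the difference quotient at s is
   restricted to increments h with 0 <= s + h, which gives the two-sided
   derivative for s > 0 and the right derivative at s = 0. *)
Definition solves_on_nonneg (L : 'M[R[i]]_n -> 'M[R[i]]_n)
    (rho : R -> 'M[R[i]]_n) : Prop :=
  forall s : R, 0 <= s ->
    (h^-1)%:C *: (rho (s + h) - rho s)
      @[h --> within [set h | 0 <= s + h] (0 : R)^'] --> L (rho s).

Definition expmx S : 'M[R[i]]_n :=
  lim (series (fun k : nat => (k`!%:R : R[i])^-1 *: S ^+ k) @ \oo).

(* exp (t L_H) S = exp (- i H t) S exp (i H t) *)
Definition unitary_evolution (t : R) H S :=
  expmx ((- 'i * t%:C) *: H) *m S *m expmx (('i * t%:C) *: H).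

End Evolution.

(* Main.v *)
(** Write [U s = exp (i H s)].  In the interaction picture
    [sigma s = U s *m rho s *m U (- s)] the Hamiltonian part of the evolution
    cancels, so [sigma' s = U s *m L_Gamma (rho s) *m U (- s)], whose trace norm
    is at most [2 ||Gamma||_oo].  The trace norm of a matrix [A] is the maximum
    of the pairings [Re tr (W^* A)] over the contractions [W], so fixing the
    contraction that is optimal for [sigma t - sigma 0] reduces the estimate to
    the mean value theorem for one real function; conjugating back by the
    unitaries [U t] and [U (- t)] gives the bound on [rho t].  The duality also
    yields [||Gamma A||_1, ||A Gamma||_1 <= ||Gamma||_oo ||A||_1]. *)
Require Import Defs.
From mathcomp Require Import all_boot all_order all_algebra.
From mathcomp Require Import all_classical all_reals all_analysis.
From mathcomp Require Import complex ring lra.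
Set Implicit Arguments.
Unset Strict Implicit.
Unset Printing Implicit Defensive.
Import Order.TTheory GRing.Theory Num.Theory.
Import numFieldTopology.Exports numFieldNormedType.Exports.
Local Open Scope ring_scope.

(** * Duality between the trace norm and contractions *)

Section FrobeniusPairing.
Local Open Scope sesquilinear_scope.
Variable R : realType.
Local Notation C := R[i].
Local Notation Re := (@complex.Re R).
Local Notation Im := (@complex.Im R).

Lemma complex_ReD (x y : C) : Re (x + y) = Re x + Re y.
Proof. by case: x; case: y. Qed.

Lemma complex_ImD (x y : C) : Im (x + y) = Im x + Im y.
Proof. by case: x; case: y. Qed.

Lemma complex_ReN (x : C) : Re (- x) = - Re x.
Proof. by case: x. Qed.

Lemma complex_ImN (x : C) : Im (- x) = - Im x.
Proof. by case: x. Qed.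

Lemma complex_ReM (x y : C) : Re (x * y) = Re x * Re y - Im x * Im y.
Proof. by case: x; case: y. Qed.

Lemma complex_ImM (x y : C) : Im (x * y) = Re x * Im y + Im x * Re y.
Proof. by case: x; case: y. Qed.

Lemma complex_Re_sum (I : finType) (f : I -> C) : Re (\sum_i f i) = \sum_i Re (f i).
Proof. by apply: (big_morph Re complex_ReD). Qed.

Lemma complex_Im_sum (I : finType) (f : I -> C) : Im (\sum_i f i) = \sum_i Im (f i).
Proof. by apply: (big_morph Im complex_ImD). Qed.

Lemma complex_Re_realM (a : R) (x : C) : Re (a%:C%C * x) = a * Re x.
Proof. by rewrite complex_ReM /= mul0r subr0. Qed.

Lemma complex_Re_conjM (x y : C) : Re (x^* * y) = Re x * Re y + Im x * Im y.
Proof.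
by rewrite complex_ReM; case: x => a b; case: y => c d /=; rewrite mulNr opprK.
Qed.

Lemma adjmxE m n (A : 'M[C]_(m, n)) i j : (A^t* ) i j = (A j i)^*.
Proof. by rewrite !mxE. Qed.

(** The real part of the Hilbert-Schmidt inner product, that is, the Euclidean inner product of the
    real and imaginary parts of the entries. On column vectors [trace_pairing v v] is the squared
    length of [v]. *)
Definition trace_pairing m n (A B : 'M[C]_(m, n)) : R := Re (\tr (A^t* *m B)).

Lemma trace_pairingE m n (A B : 'M[C]_(m, n)) :
  trace_pairing A B = \sum_j \sum_i (Re (A i j) * Re (B i j) + Im (A i j) * Im (B i j)).
Proof.
rewrite /trace_pairing /mxtrace complex_Re_sum; apply: eq_bigr => j _.
by rewrite mxE complex_Re_sum; apply: eq_bigr => i _; rewrite !mxE complex_Re_conjM.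
Qed.

Lemma trace_pairingC m n (A B : 'M[C]_(m, n)) : trace_pairing A B = trace_pairing B A.
Proof.
rewrite !trace_pairingE; apply: eq_bigr => j _; apply: eq_bigr => i _.
by rewrite mulrC [Im _ * _]mulrC.
Qed.

Lemma trace_pairingDr m n (A B B' : 'M[C]_(m, n)) :
  trace_pairing A (B + B') = trace_pairing A B + trace_pairing A B'.
Proof. by rewrite /trace_pairing mulmxDr linearD complex_ReD. Qed.

Lemma trace_pairingNr m n (A B : 'M[C]_(m, n)) :
  trace_pairing A (- B) = - trace_pairing A B.
Proof. by rewrite /trace_pairing mulmxN linearN complex_ReN. Qed.

Lemma trace_pairingZr m n (a : R) (A B : 'M[C]_(m, n)) :
  trace_pairing A (a%:C%C *: B) = a * trace_pairing A B.
Proof. by rewrite /trace_pairing -scalemxAr linearZ complex_Re_realM. Qed.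

Lemma trace_pairingDl m n (A B B' : 'M[C]_(m, n)) :
  trace_pairing (B + B') A = trace_pairing B A + trace_pairing B' A.
Proof. by rewrite trace_pairingC trace_pairingDr !(trace_pairingC A). Qed.

Lemma trace_pairingNl m n (A B : 'M[C]_(m, n)) :
  trace_pairing (- B) A = - trace_pairing B A.
Proof. by rewrite trace_pairingC trace_pairingNr trace_pairingC. Qed.

Lemma trace_pairingZl m n (a : R) (A B : 'M[C]_(m, n)) :
  trace_pairing (a%:C%C *: B) A = a * trace_pairing B A.
Proof. by rewrite trace_pairingC trace_pairingZr trace_pairingC. Qed.

Lemma trace_pairing_ge0 m n (A : 'M[C]_(m, n)) : 0 <= trace_pairing A A.
Proof.
by rewrite trace_pairingE; apply: sumr_ge0 => j _; apply: sumr_ge0 => i _;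
  rewrite addr_ge0 // -expr2 sqr_ge0.
Qed.

Lemma trace_pairing_eq0 m n (A : 'M[C]_(m, n)) : trace_pairing A A = 0 -> A = 0.
Proof.
rewrite trace_pairingE => /eqP; rewrite psumr_eq0; last first.
  by move=> j _; apply: sumr_ge0 => i _; rewrite addr_ge0 // -expr2 sqr_ge0.
move=> /allP A0; apply/matrixP => i j; rewrite mxE.
have := A0 j (mem_index_enum j); rewrite /= psumr_eq0; last first.
  by move=> k _; rewrite addr_ge0 // -expr2 sqr_ge0.
move=> /allP/(_ i (mem_index_enum i)) /=; rewrite -!expr2 paddr_eq0 ?sqr_ge0 //.
by rewrite !sqrf_eq0; case: (A i j) => a b /= /andP[/eqP-> /eqP->].
Qed.

Lemma trace_pairing_mulmxl m n p
  (A : 'M[C]_(m, p)) (X : 'M[C]_(p, n)) (B : 'M[C]_(m, n)) :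
  trace_pairing (A *m X) B = trace_pairing X (A^t* *m B).
Proof. by rewrite /trace_pairing trmx_mul map_mxM mulmxA. Qed.

Lemma trace_pairing_mulmxr m n p
  (A : 'M[C]_(m, p)) (X : 'M[C]_(p, n)) (B : 'M[C]_(m, n)) :
  trace_pairing (A *m X) B = trace_pairing A (B *m X^t*).
Proof. by rewrite /trace_pairing trmx_mul map_mxM -mulmxA mxtrace_mulC mulmxA. Qed.

Lemma trace_pairing_col m n (A B : 'M[C]_(m, n)) :
  trace_pairing A B = \sum_j trace_pairing (col j A) (col j B).
Proof.
rewrite trace_pairingE; apply: eq_bigr => j _; rewrite trace_pairingE big_ord1.
by apply: eq_bigr => i _; rewrite !mxE.
Qed.

Lemma col_mulmx m n p (A : 'M[C]_(m, n)) (B : 'M[C]_(n, p)) j :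
  col j (A *m B) = A *m col j B.
Proof. by rewrite !colE mulmxA. Qed.

Lemma trace_pairing_CauchySchwarz m n (A B : 'M[C]_(m, n)) :
  trace_pairing A B <= Num.sqrt (trace_pairing A A) * Num.sqrt (trace_pairing B B).
Proof.
set a := Num.sqrt (trace_pairing A A); set b := Num.sqrt (trace_pairing B B).
have a2 : a ^+ 2 = trace_pairing A A by rewrite sqr_sqrtr ?trace_pairing_ge0.
have b2 : b ^+ 2 = trace_pairing B B by rewrite sqr_sqrtr ?trace_pairing_ge0.
have a0 : 0 <= a by rewrite sqrtr_ge0.
have b0 : 0 <= b by rewrite sqrtr_ge0.
have [aE|an0] := eqVneq a 0.
  have /trace_pairing_eq0 -> : trace_pairing A A = 0 by rewrite -a2 aE expr0n.
  by rewrite aE mul0r trace_pairingC /trace_pairing mulmx0 linear0.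
have [bE|bn0] := eqVneq b 0.
  have /trace_pairing_eq0 -> : trace_pairing B B = 0 by rewrite -b2 bE expr0n.
  by rewrite bE mulr0 /trace_pairing mulmx0 linear0.
have ab : 0 < a * b by rewrite mulr_gt0 // lt0r ?an0 ?bn0.
(* With [a], [b] the lengths of [A], [B], the squared length of [b A - a B] is
   [2 a b (a b - <A, B>)]; dividing by [a b > 0] gives the claim. *)
have := trace_pairing_ge0 (b%:C%C *: A + - (a%:C%C *: B)).
rewrite !(trace_pairingDr, trace_pairingDl, trace_pairingNr, trace_pairingNl,
  trace_pairingZr, trace_pairingZl) [trace_pairing B A]trace_pairingC -a2 -b2.
move=> h; rewrite -subr_ge0 -(pmulr_rge0 _ ab); nra.
Qed.

(** * Singular vectors, contractions and the dual form of the trace norm *)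

Variable n : nat.
Implicit Types (A B W G U : 'M[C]_n) (v : 'cV[C]_n).

(** For [c >= 0] this says that [W] has operator norm at most [c]. Quantifying over vectors lets
    bounds be multiplied along products without comparing singular values. *)
Definition bounded_by (c : R) W :=
  forall v, trace_pairing (W *m v) (W *m v) <= c ^+ 2 * trace_pairing v v.

Lemma unitarymxK U : U \is unitarymx -> U *m U^t* = 1%:M.
Proof. by move/unitarymxP. Qed.

Lemma unitarymxKt U : U \is unitarymx -> U^t* *m U = 1%:M.
Proof.
by move=> hU; rewrite -[X in _ *m X]trmxCK; apply: unitarymxK; rewrite trmxC_unitary.
Qed.

Lemma trace_pairing_unitary m U (X Y : 'M[C]_(n, m)) :
  U \is unitarymx -> trace_pairing (U *m X) (U *m Y) = trace_pairing X Y.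
Proof. by move=> hU; rewrite trace_pairing_mulmxl mulmxA unitarymxKt // mul1mx. Qed.

Lemma spectral_gram A (M := A^t* *m A) :
  M = (spectralmx M)^t* *m diag_mx (spectral_diag M) *m spectralmx M.
Proof.
rewrite -invmx_unitary ?spectral_unitarymx //;
  apply/orthomx_spectralP/hermitian_normalmx.
by rewrite is_hermitianmxE expr0 scale1r /M trmx_mul map_mxM trmxCK.
Qed.

(* [spectralmx] lists eigenvectors as rows; the columns of its adjoint are the
   right singular vectors of [A]. *)
Definition eigbasis A := (spectralmx (A^t* *m A))^t*.

Lemma eigbasis_unitary A : eigbasis A \is unitarymx.
Proof. by rewrite /eigbasis trmxC_unitary spectral_unitarymx. Qed.

(** The singular value decomposition in Gram form: [A] sends the right singular vectors to pairwise
    orthogonal vectors whose squared lengths are the eigenvalues of [A^t* *m A]. *)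
Lemma gram_eigbasis A :
  (A *m eigbasis A)^t* *m (A *m eigbasis A) = diag_mx (spectral_diag (A^t* *m A)).
Proof.
rewrite trmx_mul map_mxM !mulmxA -[_ *m A]mulmxA [X in _ *m X *m _]spectral_gram.
rewrite /eigbasis trmxCK -!mulmxA unitarymxK ?spectral_unitarymx // mulmx1 mulmxA.
by rewrite unitarymxK ?spectral_unitarymx // mul1mx.
Qed.

(** Diagonal entries of [gram_eigbasis]. They are squared lengths, hence real and nonnegative, which
    justifies the real part and the square root in [singular_value]. *)
Lemma spectral_diag_gram A j :
  spectral_diag (A^t* *m A) 0 j =
  (trace_pairing (A *m col j (eigbasis A)) (A *m col j (eigbasis A)))%:C%C.
Proof.
have /matrixP/(_ j j) := gram_eigbasis A; rewrite !mxE eqxx mulr1n => <-.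
rewrite trace_pairingE big_ord1 raddf_sum /=; apply: eq_bigr => i _;
  rewrite -col_mulmx !mxE.
by rewrite -!expr2 add_Re2_Im2 normCK mulrC.
Qed.

Lemma singular_valueE A j :
  singular_value A j =
  Num.sqrt (trace_pairing (A *m col j (eigbasis A)) (A *m col j (eigbasis A))).
Proof. by rewrite /singular_value spectral_diag_gram. Qed.

Lemma spectral_diag_singular A j :
  spectral_diag (A^t* *m A) 0 j = (singular_value A j ^+ 2)%:C%C.
Proof. by rewrite spectral_diag_gram singular_valueE sqr_sqrtr ?trace_pairing_ge0. Qed.

Lemma singular_value_ge0 A j : 0 <= singular_value A j.
Proof. exact: sqrtr_ge0. Qed.

(** Expand [v] in the right singular vectors: their images under [A] are orthogonal, so the squared
    lengths add up. *)
Lemma trace_pairing_gram A v : trace_pairing (A *m v) (A *m v) =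
  \sum_j singular_value A j ^+ 2 * Re (`|((eigbasis A)^t* *m v) j 0| ^+ 2).
Proof.
rewrite -{1 2}[v]mul1mx -(unitarymxK (eigbasis_unitary A)) -!mulmxA.
rewrite [A *m _]mulmxA trace_pairing_mulmxl (mulmxA ((A *m eigbasis A)^t* ))
  gram_eigbasis /trace_pairing trace_mx11 mxE complex_Re_sum.
apply: eq_bigr => j _; rewrite adjmxE mul_diag_mx [(\matrix_(_, _) _) _ _]mxE.
by rewrite spectral_diag_singular mulrCA complex_Re_realM [_^* * _]mulrC -normCK.
Qed.

Lemma trace_pairing_eigbasis A v :
  trace_pairing v v = \sum_j Re (`|((eigbasis A)^t* *m v) j 0| ^+ 2).
Proof.
have hU : (eigbasis A)^t* \is unitarymx by rewrite trmxC_unitary eigbasis_unitary.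
rewrite -(trace_pairing_unitary v v hU).
rewrite /trace_pairing trace_mx11 mxE complex_Re_sum; apply: eq_bigr => j _.
by rewrite adjmxE mulrC -normCK.
Qed.

Lemma Re_normC2_ge0 (z : C) : 0 <= Re (`|z| ^+ 2).
Proof. by rewrite -add_Re2_Im2 /= addr_ge0 // sqr_ge0. Qed.

Lemma operator_norm_ge0 A : 0 <= operator_norm A.
Proof.
rewrite /operator_norm; elim/big_ind: _ => // [x y x0 y0|j _].
  by rewrite le_max x0.
exact: singular_value_ge0.
Qed.

Lemma singular_value_le A j : singular_value A j <= operator_norm A.
Proof. by rewrite /operator_norm (bigmaxD1 j) //= le_max lexx. Qed.

Lemma operator_norm_bound A : bounded_by (operator_norm A) A.
Proof.
move=> v; rewrite trace_pairing_gram (trace_pairing_eigbasis A v) mulr_sumr;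
  apply: ler_sum => j _.
apply: ler_wpM2r; first exact: Re_normC2_ge0.
by rewrite ler_sqr ?nnegrE ?operator_norm_ge0 ?singular_value_ge0 ?singular_value_le.
Qed.

(** Evaluated in the right singular basis [v_j] of [A], the pairing is the sum of the
    [<W v_j, A v_j>]. Each term is at most [|W v_j| |A v_j|] by Cauchy-Schwarz, hence at most [c]
    times the j-th singular value. *)
Lemma trace_pairing_le_trace_norm c W A :
  0 <= c -> bounded_by c W -> trace_pairing W A <= c * trace_norm A.
Proof.
move=> c0 hW.
have -> : trace_pairing W A = trace_pairing (W *m eigbasis A) (A *m eigbasis A).
  by rewrite trace_pairing_mulmxr -mulmxA unitarymxK ?mulmx1 // eigbasis_unitary.
rewrite trace_pairing_col /trace_norm mulr_sumr; apply: ler_sum => j _.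
apply: (le_trans (trace_pairing_CauchySchwarz _ _)).
rewrite (col_mulmx W) (col_mulmx A) -(singular_valueE A j).
apply: ler_wpM2r; first exact: singular_value_ge0.
rewrite -[leRHS]ger0_norm // -sqrtr_sqr ler_sqrt ?sqr_ge0 //.
apply: le_trans (hW _) _.
have -> : trace_pairing (col j (eigbasis A)) (col j (eigbasis A)) = 1;
  last by rewrite mulr1.
rewrite colE trace_pairing_unitary ?eigbasis_unitary //
  trace_pairingE big_ord1 (bigD1 j) //= big1 ?addr0.
  by rewrite !mxE !eqxx /= mulr1 mulr0 addr0.
by move=> i ij; rewrite !mxE (negPf ij) /= !mulr0 addr0.
Qed.

(* [W] is the partial isometry of the polar decomposition of [A]: it sends the
   j-th right singular vector v to A v / sigma_j, and to 0 when sigma_j = 0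
   because 0^-1 = 0. *)
Lemma trace_norm_attained A :
  exists2 W, bounded_by 1 W & trace_pairing W A = trace_norm A.
Proof.
pose D : 'M[C]_n := diag_mx (\row_j ((singular_value A j)^-1)%:C%C).
exists (A *m (eigbasis A *m (D *m (eigbasis A)^t* ))); last first.
  rewrite !mulmxA trace_pairing_mulmxr trmxCK trace_pairing_col.
  rewrite /trace_norm; apply: eq_bigr => j _.
  have -> : col j (A *m eigbasis A *m D) =
    ((singular_value A j)^-1)%:C%C *: col j (A *m eigbasis A).
    by apply/matrixP => i k; rewrite /D mul_mx_diag !mxE mulrC.
  rewrite trace_pairingZl col_mulmx -{1}(sqr_sqrtr (trace_pairing_ge0 _))
    -(singular_valueE A j).
  have [->|s0] := eqVneq (singular_value A j) 0; first by rewrite expr0n mulr0.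
  by rewrite expr2 mulKf.
(* In the singular basis the j-th squared coordinate of [v] is multiplied by the square of
   [s * s^-1], which is 1, or 0 when [s = 0]; so the length does not grow. *)
move=> v; rewrite expr1n mul1r -mulmxA trace_pairing_gram (trace_pairing_eigbasis A v).
apply: ler_sum => j _; rewrite !mulmxA unitarymxKt ?eigbasis_unitary // mul1mx.
rewrite -mulmxA mul_diag_mx ![(\matrix_(_, _) _) _ _]mxE normrM exprMn.
set s := singular_value A j; set z := _ j 0.
have -> : `|(s^-1)%:C%C| ^+ 2 = ((s^-1) ^+ 2)%:C%C :> C.
  by rewrite -add_Re2_Im2 /= expr0n addr0.
rewrite complex_Re_realM mulrA.
have [->|s0] := eqVneq s 0; first by rewrite (expr2 0) !mul0r Re_normC2_ge0.
by rewrite -exprMn divff // expr1n mul1r.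
Qed.

Lemma trace_norm_le A c :
  (forall W, bounded_by 1 W -> trace_pairing W A <= c) -> trace_norm A <= c.
Proof. by move=> h; have [W /h + <-] := trace_norm_attained A. Qed.

Lemma trace_norm_ge0 A : 0 <= trace_norm A.
Proof. by apply: sumr_ge0 => j _; exact: singular_value_ge0. Qed.

(** * Trace norm bounds for unitary conjugation and for the dissipative term *)

Lemma bounded_byM c d A B :
  bounded_by c A -> bounded_by d B -> bounded_by (c * d) (A *m B).
Proof.
move=> hA hB v; rewrite -mulmxA exprMn -mulrA; apply: le_trans (hA _) _.
by apply: ler_wpM2l; [exact: sqr_ge0|exact: hB].
Qed.

Lemma unitary_bounded U : U \is unitarymx -> bounded_by 1 U.
Proof. by move=> hU v; rewrite expr1n mul1r trace_pairing_unitary. Qed.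

Lemma hermitian_adj G : G \is hermsymmx -> G^t* = G.
Proof. by rewrite is_hermitianmxE expr0 scale1r => /eqP <-. Qed.

(** By duality: [<W, U A V> = <U^t* W V^t*, A>], and [U^t* W V^t*] is again a contraction. *)
Lemma trace_norm_unitary U V A : U \is unitarymx -> V \is unitarymx ->
  trace_norm (U *m A *m V) <= trace_norm A.
Proof.
move=> hU hV; apply: trace_norm_le => W hW.
rewrite -[V]trmxCK -trace_pairing_mulmxr -[U]trmxCK -trace_pairing_mulmxl -[leRHS]mul1r.
have -> : 1 = 1 * (1 * 1) :> R by rewrite !mulr1.
have /unitary_bounded bU : U^t* \is unitarymx by rewrite trmxC_unitary hU.
have /unitary_bounded bV : V^t* \is unitarymx by rewrite trmxC_unitary hV.
apply: trace_pairing_le_trace_norm; first by rewrite !mulr1.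
exact: (bounded_byM bU (bounded_byM hW bV)).
Qed.

(** Pair with a contraction [W] and move the sign and the Hermitian [G] onto it: the two terms
    become pairings of [A] with [G (- W)] and [(- W) G], both bounded by [operator_norm G]. Each
    contributes one copy of the bound, whence the factor 2. *)
Lemma trace_norm_liouvillian_G G A : G \is hermsymmx ->
  trace_norm (liouvillian_G G A) <= 2 * operator_norm G * trace_norm A.
Proof.
move=> /hermitian_adj hG; apply: trace_norm_le => W hW.
have hN : bounded_by 1 (- W).
  by move=> v; rewrite mulNmx trace_pairingNl trace_pairingNr opprK; exact: hW.
have hO := @operator_norm_bound G.
rewrite /liouvillian_G trace_pairingNr -trace_pairingNl /anticommutator
  trace_pairingDr mulr_natl mulr2n mulrDl lerD //.
  rewrite -{1}hG -trace_pairing_mulmxl -[operator_norm G]mulr1.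
  by apply: trace_pairing_le_trace_norm;
    [rewrite mulr1 operator_norm_ge0|exact: bounded_byM].
rewrite -{1}hG -trace_pairing_mulmxr -[operator_norm G]mul1r.
by apply: trace_pairing_le_trace_norm;
  [rewrite mul1r operator_norm_ge0|exact: bounded_byM].
Qed.

Lemma norm_1to1_liouvillian_G G : G \is hermsymmx ->
  (norm_1to1 (liouvillian_G G) <= (2 * operator_norm G)%:E)%E.
Proof.
move=> hG; apply: ge_ereal_sup => _ [S _ <-]; rewrite lee_fin.
(* A vanishing denominator makes the quotient 0, since [0^-1 = 0]. *)
have [->|S0] := eqVneq (trace_norm S) 0.
  by rewrite invr0 mulr0 mulr_ge0 // operator_norm_ge0.
rewrite ler_pdivrMr; first exact: trace_norm_liouvillian_G.
by rewrite lt0r S0 trace_norm_ge0.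
Qed.

End FrobeniusPairing.

(** * The series of exp (i y) *)

Section Convergence.
Local Open Scope classical_set_scope.
Variable R : realType.
Local Notation C := R[i].
Local Notation Re := (@complex.Re R).
Local Notation Im := (@complex.Im R).

Lemma norm_real_complex (x : R) : `|x%:C%C| = `|x|%:C%C :> C.
Proof. by rewrite normc_def /= expr0n addr0 sqrtr_sqr. Qed.

Lemma real_complex_continuous : continuous (fun x : R => x%:C%C : C).
Proof.
move=> x; apply/cvgrPdist_lt => e e0.
have e0' : 0 < Re e by move: e0; rewrite ltcE => /andP[].
have eE : e = (Re e)%:C%C by rewrite RRe_real // gtr0_real.
near=> y; rewrite -raddfB /= norm_real_complex eE ltcR.
by near: y; apply: cvgr_dist_lt.
Unshelve. all: by end_near. Qed.

Lemma Re_continuous : continuous (Re : C -> R).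
Proof.
move=> x A /nbhs_ballP[e /= e0 eA]; apply/(nbhs_ballP (x : C)).
exists e%:C%C; first by rewrite /= ltcR.
move=> y xy; apply: eA; change (`|Re x - Re y| < e).
rewrite -ltcR; apply: le_lt_trans xy; rewrite -complex_ReN -complex_ReD.
exact: normc_ge_Re.
Qed.

Lemma normc_ge_Im (z : C) : `|Im z|%:C%C <= `|z|.
Proof.
by rewrite normc_def lecR -sqrtr_sqr ler_wsqrtr // lerDr sqr_ge0.
Qed.

Lemma Im_continuous : continuous (Im : C -> R).
Proof.
move=> x A /nbhs_ballP[e /= e0 eA]; apply/(nbhs_ballP (x : C)).
exists e%:C%C; first by rewrite /= ltcR.
move=> y xy; apply: eA; change (`|Im x - Im y| < e).
rewrite -ltcR; apply: le_lt_trans xy; rewrite -complex_ImN -complex_ImD.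
exact: normc_ge_Im.
Qed.

Lemma cvg_complex (T : Type) (F : set_system T) (FF : Filter F) (u : T -> C) (z : C) :
  (Re (u t) @[t --> F] --> Re z) -> (Im (u t) @[t --> F] --> Im z) ->
  u t @[t --> F] --> z.
Proof.
move=> hr hi; have uE : u = (fun t => (Re (u t))%:C%C + 'i%C * (Im (u t))%:C%C).
  by apply/funext => t; exact: complexE.
rewrite uE [z]complexE; apply: cvgD.
  exact: (cvg_comp _ _ hr (@real_complex_continuous _)).
apply: cvgM; first exact: cvg_cst.
exact: (cvg_comp _ _ hi (@real_complex_continuous _)).
Qed.

(** A neighbourhood of a matrix contains a product of neighbourhoods of its entries, and the
    finitely many entry conditions hold simultaneously along [F]. *)
Lemma cvg_mx (T : Type) (F : set_system T) (FF : Filter F) m n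
  (u : T -> 'M[C]_(m, n)) (A : 'M[C]_(m, n)) :
  (forall i j, u t i j @[t --> F] --> A i j) -> u t @[t --> F] --> A.
Proof.
move=> h B [P hP sPB]; apply: (@filterS _ F _ [set t | forall i j, P i j (u t i j)]).
  by move=> t ht; apply: sPB.
apply: filter_forall => i; apply: filter_forall => j.
exact: (h i j _ (hP i j)).
Qed.

(** This is [exp (i y)], given by cosine and sine so that their series and derivatives apply
    directly. *)
Definition cis (y : R) : C := (cos y +i* sin y)%C.

Lemma exp_coeff_cis (y : R) k :
  (k`!%:R : C)^-1 * ('i%C * y%:C%C) ^+ k = (cos_coeff y k +i* sin_coeff y k)%C.
Proof.
have cE (a b c d : R) : a = c -> b = d -> (a +i* b)%C = (c +i* d)%C by move=> -> ->.
(* Powers of [i] split by parity in the shape used by [cos_coeff] and [sin_coeff]; at [k = 0] the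
   truncated predecessor is harmless, as the factor [odd k] vanishes. *)
have h : ('i%C : C) ^+ k =
    (((~~ odd k)%:R * (-1) ^+ k./2) +i* ((odd k)%:R * (-1) ^+ k.-1./2))%C.
  elim: k => [|k IH]; first by apply: cE; rewrite /= ?mul0r ?mulr1.
  rewrite exprS {}IH; case: k => [|k]; first by apply: cE => /=; ring.
  by apply: cE; rewrite /= uphalf_half; case: (odd k);
    rewrite /= ?add1n ?add0n ?exprS; ring.
rewrite exprMn h /cos_coeff /sin_coeff /=.
have -> : (k`!%:R : C)^-1 = (k`!%:R^-1 : R)%:C%C by rewrite fmorphV rmorph_nat.
rewrite -rmorphXn /=; simpc; by congr (_ +i* _)%C; rewrite mulrC -?exprnP.
Qed.

Lemma cvg_exp_series_cis (y : R) :
  series (fun k => (k`!%:R : C)^-1 * ('i%C * y%:C%C) ^+ k) @ \oo --> cis y.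
Proof.
have -> : (fun k => (k`!%:R : C)^-1 * ('i%C * y%:C%C) ^+ k) =
  (fun k => (cos_coeff y k +i* sin_coeff y k)%C).
  by apply/funext => k; exact: exp_coeff_cis.
apply: cvg_complex => /=.
  have -> : (fun t => Re (series (fun k => (cos_coeff y k +i* sin_coeff y k)%C) t)) =
      series (cos_coeff y).
    by apply/funext => N; rewrite /series /= (big_morph Re (@complex_ReD R) (erefl _)).
  by rewrite cos.unlock; exact: is_cvg_series_cos_coeff.
have -> : (fun t => Im (series (fun k => (cos_coeff y k +i* sin_coeff y k)%C) t)) =
    series (sin_coeff y).
  by apply/funext => N; rewrite /series /= (big_morph Im (@complex_ImD R) (erefl _)).
by rewrite sin.unlock; exact: is_cvg_series_sin_coeff.
Qed.

End Convergence.

(** * Unitary propagators and the interaction picture *)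

Section Propagator.
Local Open Scope sesquilinear_scope.
Local Open Scope classical_set_scope.
Variables (R : realType) (n : nat).
Local Notation C := R[i].
Local Notation Re := (@complex.Re R).
Local Notation Im := (@complex.Im R).
Implicit Types (H : 'M[C]_n) (x y : R).

Definition energy H j : R := Re (spectral_diag H 0 j).

(** For Hermitian [H] this is [exp (i x H)], in spectral form: unitarity, the derivative and
    commutation with [H] reduce to diagonal entries. The Schroedinger evolution [exp (- i H t)] is
    [propagator (- t) H]. *)
Definition propagator x H : 'M[C]_n :=
  (spectralmx H)^t* *m diag_mx (\row_j cis (x * energy H j)) *m spectralmx H.

Lemma hermitian_spectralE H : H \is hermsymmx ->
  H = (spectralmx H)^t* *m diag_mx (\row_j (energy H j)%:C%C) *m spectralmx H.
Proof.
move=> hH; have /orthomx_spectralP {1}-> := hermitian_normalmx hH.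
rewrite invmx_unitary ?spectral_unitarymx //; congr (_ *m diag_mx _ *m _).
have /mxOverP hr := hermitian_spectral_diag_real hH.
by apply/rowP => j; rewrite mxE /energy RRe_real.
Qed.

Lemma exprmx_spectral H (z : C) k : H \is hermsymmx ->
  (z *: H) ^+ k =
  (spectralmx H)^t* *m diag_mx (\row_j (z * (energy H j)%:C%C) ^+ k) *m spectralmx H.
Proof.
move=> hH; have U := spectral_unitarymx H.
elim: k => [|k IH].
  have -> : (\row_j (z * (energy H j)%:C%C) ^+ 0) = const_mx 1 :> 'rV[C]_n.
    by apply/rowP => j; rewrite !mxE expr0.
  by rewrite expr0 diag_const_mx mulmx1 unitarymxKt.
rewrite exprS IH {1}(hermitian_spectralE hH) -[LHS]/(_ *m _) -scalemxAl -!mulmxA.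
rewrite (mulmxA (spectralmx H) ((spectralmx H)^t* )) unitarymxK // mul1mx.
rewrite scalemxAr; congr (_ *m _); rewrite scalemxAl mulmxA; congr (_ *m _).
rewrite -scalemxAl mulmx_diag -linearZ /=; congr diag_mx.
by apply/rowP => j; rewrite !mxE exprS mulrA.
Qed.

Lemma conj_diag_mxE (P : 'M[C]_n) (d : 'rV[C]_n) i j :
  (P^t* *m diag_mx d *m P) i j = \sum_l (P l i)^* * P l j * d 0 l.
Proof.
by rewrite mul_mx_diag mxE; apply: eq_bigr => l _; rewrite !mxE mulrAC.
Qed.

(** In the eigenbasis every entry of a partial sum is a fixed linear combination of partial sums of
    the scalar series of [exp (i x E_l)], with [E_l] the eigenvalues. These converge to [cis], and
    the limit is unique because the space is Hausdorff. *)
Lemma expmx_hermitian H x :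
  H \is hermsymmx -> expmx (('i%C * x%:C%C) *: H) = propagator x H.
Proof.
move=> hH; rewrite /expmx; apply: cvg_lim; first exact: norm_hausdorff.
apply: cvg_mx => i j.
have -> : (fun t => series (fun k =>
  (k`!%:R : C)^-1 *: (('i%C * x%:C%C) *: H) ^+ k) t i j) =
  (fun t => \sum_l (spectralmx H l i)^* * spectralmx H l j *
     series (fun k => (k`!%:R : C)^-1 * ('i%C * (x * energy H l)%:C%C) ^+ k) t).
  apply/funext => N; rewrite /series /= summxE.
  under [RHS]eq_bigr => l _ do rewrite big_distrr /=.
  rewrite exchange_big /=; apply: eq_bigr => k _.
  rewrite mxE exprmx_spectral // conj_diag_mxE big_distrr /=; apply: eq_bigr => l _.
  by rewrite mxE rmorphM /= mulrCA !mulrA.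
rewrite /propagator conj_diag_mxE; under eq_bigr => l _ do rewrite mxE.
apply: cvg_big => [|l _]; first exact: add_continuous.
apply: cvgM; first exact: cvg_cst.
exact: cvg_exp_series_cis.
Qed.

Lemma cisC y : (cis y)^* = cis (- y).
Proof. by rewrite /cis cosN sinN. Qed.

Lemma cis_mulN y : cis y * cis (- y) = 1.
Proof.
rewrite /cis cosN sinN; apply/eqP; rewrite eq_complex /= -(cos2Dsin2 y).
by apply/andP; split; apply/eqP; ring.
Qed.

Lemma propagatorN x H : propagator (- x) H = (propagator x H)^t*.
Proof.
rewrite /propagator !trmx_mul !map_mxM trmxCK tr_diag_mx map_diag_mx mulmxA.
congr (_ *m diag_mx _ *m _); apply/rowP => j; rewrite !mxE mulNr.
by rewrite -cisC.
Qed.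

Lemma propagator_unitary x H : propagator x H \is unitarymx.
Proof.
have U := spectral_unitarymx H.
apply/unitarymxP; rewrite -propagatorN /propagator -!mulmxA.
rewrite (mulmxA (spectralmx H) ((spectralmx H)^t* )) unitarymxK // mul1mx.
rewrite (mulmxA (diag_mx _)) mulmx_diag.
have -> : (\row_j ((\row_j0 cis (x * energy H j0)) 0 j * (\row_j0 cis (- x * energy H
  j0)) 0 j)) = const_mx 1 :> 'rV[C]_n.
  by apply/rowP => j; rewrite !mxE mulNr cis_mulN.
by rewrite diag_const_mx mul1mx unitarymxKt.
Qed.

Lemma propagator0 H : propagator 0 H = 1%:M.
Proof.
rewrite /propagator.
have -> : (\row_j cis (0 * energy H j)) = const_mx 1 :> 'rV[C]_n.
  by apply/rowP => j; rewrite !mxE mul0r /cis cos0 sin0.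
by rewrite diag_const_mx mulmx1 unitarymxKt // spectral_unitarymx.
Qed.

Lemma unitary_evolutionE t H S : H \is hermsymmx ->
  unitary_evolution t H S = propagator (- t) H *m S *m propagator t H.
Proof.
move=> hH; rewrite /unitary_evolution (expmx_hermitian t hH).
by rewrite -(expmx_hermitian (- t) hH) rmorphN /= mulrN mulNr.
Qed.

(* [is_derive] needs a normed module over [R], which [R[i]] is not, so derivatives
   in a real variable are taken on real and imaginary parts. *)
Definition mderive m p (F : R -> 'M[C]_(m, p)) s (D : 'M[C]_(m, p)) :=
  forall i j, is_derive s (1 : R) (fun x => Re (F x i j)) (Re (D i j)) /\
              is_derive s (1 : R) (fun x => Im (F x i j)) (Im (D i j)).

Lemma is_derive_sumE (I : finType) (f : I -> R -> R) s (d : I -> R) :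
  (forall i, is_derive s (1 : R) (f i) (d i)) ->
  is_derive s (1 : R) (fun x => \sum_i f i x) (\sum_i d i).
Proof.
move=> h; have -> : (fun x => \sum_i f i x) = \sum_i f i.
  by apply/funext => x; rewrite fct_sumE.
by elim/big_ind2 : _ => // [|] *; [exact: is_derive_cst|exact: is_deriveD].
Qed.

Lemma is_derive_mulE (f g : R -> R) s df dg :
  is_derive s (1 : R) f df -> is_derive s (1 : R) g dg ->
  is_derive s (1 : R) (fun x => f x * g x) (df * g s + f s * dg).
Proof.
move=> hf hg; apply: is_derive_eq (is_deriveM hf hg) _.
by rewrite addrC mulrC.
Qed.

Lemma mderive_cst m p (A : 'M[C]_(m, p)) s : mderive (fun=> A) s 0.
Proof. by move=> i j; rewrite mxE; split; exact: is_derive_cst. Qed.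

Lemma mderiveM m p q (F : R -> 'M[C]_(m, p)) (G : R -> 'M[C]_(p, q)) s D E :
  mderive F s D -> mderive G s E ->
  mderive (fun x => F x *m G x) s (D *m G s + F s *m E).
Proof.
move=> hF hG i j; split.
  have -> : (fun x => Re ((F x *m G x) i j)) =
    (fun x => \sum_k (Re (F x i k) * Re (G x k j) - Im (F x i k) * Im (G x k j))).
    by apply/funext => x; rewrite mxE complex_Re_sum; apply: eq_bigr => k _;
      exact: complex_ReM.
  have -> : Re ((D *m G s + F s *m E) i j) = \sum_k
     ((Re (D i k) * Re (G s k j) + Re (F s i k) * Re (E k j)) -
      (Im (D i k) * Im (G s k j) + Im (F s i k) * Im (E k j))).
    rewrite mxE complex_ReD !mxE !complex_Re_sum -big_split /=.
    by apply: eq_bigr => k _; rewrite !complex_ReM; ring.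
  apply: is_derive_sumE => k; have [f1 f2] := hF i k; have [g1 g2] := hG k j.
  exact: is_deriveB (is_derive_mulE f1 g1) (is_derive_mulE f2 g2).
have -> : (fun x => Im ((F x *m G x) i j)) =
  (fun x => \sum_k (Re (F x i k) * Im (G x k j) + Im (F x i k) * Re (G x k j))).
  by apply/funext => x; rewrite mxE complex_Im_sum; apply: eq_bigr => k _;
    exact: complex_ImM.
have -> : Im ((D *m G s + F s *m E) i j) = \sum_k
   ((Re (D i k) * Im (G s k j) + Re (F s i k) * Im (E k j)) +
    (Im (D i k) * Re (G s k j) + Im (F s i k) * Re (E k j))).
  rewrite mxE complex_ImD !mxE !complex_Im_sum -big_split /=.
  by apply: eq_bigr => k _; rewrite !complex_ImM; ring.
apply: is_derive_sumE => k; have [f1 f2] := hF i k; have [g1 g2] := hG k j.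
exact: is_deriveD (is_derive_mulE f1 g2) (is_derive_mulE f2 g1).
Qed.

(** Pairing with a fixed [W] is a real-linear form in the real and imaginary parts of the entries;
    it turns a matrix curve into a real function to which the mean value theorem applies. *)
Lemma mderive_trace_pairing m p (W : 'M[C]_(m, p)) F s D : mderive F s D ->
  is_derive s (1 : R) (fun x => trace_pairing W (F x)) (trace_pairing W D).
Proof.
move=> hF; rewrite trace_pairingE; have -> : (fun x => trace_pairing W (F x)) =
  (fun x => \sum_j \sum_i (Re (W i j) * Re (F x i j) + Im (W i j) * Im (F x i j))).
  by apply/funext => x; rewrite trace_pairingE.
apply: is_derive_sumE => j; apply: is_derive_sumE => i; have [f1 f2] := hF i j.
exact: is_deriveD (is_deriveZ (Re (W i j)) f1) (is_deriveZ (Im (W i j)) f2).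
Qed.

Lemma cis_derive (a s : R) :
  is_derive s (1 : R) (fun x => Re (cis (x * a))) (Re ('i%C * a%:C%C * cis (s * a))) /\
  is_derive s (1 : R) (fun x => Im (cis (x * a))) (Im ('i%C * a%:C%C * cis (s * a))).
Proof.
have hl : is_derive s (1 : R) (fun x => x * a) a.
  by apply: is_derive_eq (is_derive_mulE (is_derive_id s 1) (is_derive_cst a s 1)) _;
    rewrite mul1r mulr0 addr0.
split.
  change (is_derive s (1 : R) (cos \o (fun x => x * a))
    (Re ('i%C * a%:C%C * cis (s * a)))).
  apply: is_derive_eq
    (@is_derive1_comp R cos (fun x => x * a) s _ _ (is_derive_cos (s * a)) hl) _ => /=.
  ring.
change (is_derive s (1 : R) (sin \o (fun x => x * a))
  (Im ('i%C * a%:C%C * cis (s * a)))).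
apply: is_derive_eq
  (@is_derive1_comp R sin (fun x => x * a) s _ _ (is_derive_sin (s * a)) hl) _ => /=.
ring.
Qed.

Lemma mderive_diag (a : 'I_n -> R) s :
  mderive (fun x => diag_mx (\row_j cis (x * a j))) s
    (diag_mx (\row_j ('i%C * (a j)%:C%C)) *m diag_mx (\row_j cis (s * a j))).
Proof.
rewrite mulmx_diag => i j; rewrite !mxE.
have [->|ij] := eqVneq i j.
  have -> : (fun x => Re (diag_mx (\row_j cis (x * a j)) j j)) =
    (fun x => Re (cis (x * a j))).
    by apply/funext => x; rewrite !mxE eqxx.
  have -> : (fun x => Im (diag_mx (\row_j cis (x * a j)) j j)) =
    (fun x => Im (cis (x * a j))).
    by apply/funext => x; rewrite !mxE eqxx.
  by rewrite mulr1n; exact: cis_derive.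
have -> : (fun x => Re (diag_mx (\row_j cis (x * a j)) i j)) = (fun=> 0).
  by apply/funext => x; rewrite !mxE (negPf ij).
have -> : (fun x => Im (diag_mx (\row_j cis (x * a j)) i j)) = (fun=> 0).
  by apply/funext => x; rewrite !mxE (negPf ij).
by rewrite mulr0n; split; exact: is_derive_cst.
Qed.

Lemma mderive_eq m p (F : R -> 'M[C]_(m, p)) s D E :
  mderive F s D -> D = E -> mderive F s E.
Proof. by move=> ? <-. Qed.

Lemma mul_hermitian_propagator H s : H \is hermsymmx ->
  H *m propagator s H = (spectralmx H)^t* *m (diag_mx (\row_j (energy H j)%:C%C) *m
    diag_mx (\row_j cis (s * energy H j))) *m spectralmx H.
Proof.
move=> hH; rewrite {1}(hermitian_spectralE hH) /propagator -!mulmxA.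
rewrite (mulmxA (spectralmx H) ((spectralmx H)^t* )) unitarymxK ?mul1mx //.
exact: spectral_unitarymx.
Qed.

Lemma propagator_comm H s : H \is hermsymmx ->
  propagator s H *m H = H *m propagator s H.
Proof.
move=> hH; rewrite mul_hermitian_propagator // diag_mxC.
rewrite {2}(hermitian_spectralE hH) /propagator -!mulmxA.
rewrite (mulmxA (spectralmx H) ((spectralmx H)^t* )) unitarymxK ?mul1mx //.
exact: spectral_unitarymx.
Qed.

Lemma mderive_propagator H s : H \is hermsymmx ->
  mderive (propagator^~ H) s ('i%C *: (H *m propagator s H)).
Proof.
move=> hH; apply: mderive_eq 
  (mderiveM (mderiveM (mderive_cst _ s) (mderive_diag _ s)) (mderive_cst _ s)) _.
rewrite mulmx0 addr0 mul0mx add0r mul_hermitian_propagator //.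
rewrite scalemxAl scalemxAr scalemxAl; congr (_ *m (_ *m _) *m _).
by rewrite -linearZ; congr diag_mx; apply/rowP => j; rewrite !mxE.
Qed.

Lemma adjmxZ m p (a : C) (A : 'M[C]_(m, p)) : (a *: A)^t* = a^* *: A^t*.
Proof. by apply/matrixP => i j; rewrite !mxE rmorphM. Qed.

(** Since [propagator (- x) H] is the adjoint of [propagator x H], its derivative is the adjoint of
    the derivative already found: indices are swapped, real parts kept and imaginary parts
    negated. *)
Lemma mderive_propagatorN H s : H \is hermsymmx ->
  mderive (fun x => propagator (- x) H) s (- ('i%C *: (propagator (- s) H *m H))).
Proof.
move=> hH i j.
have := mderive_propagator s hH j i => -[h1 h2].
have E y : propagator (- y) H i j = (propagator y H j i)^*.
  by rewrite propagatorN adjmxE.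
have -> : (fun x => Re (propagator (- x) H i j)) = (fun x => Re (propagator x H j i)).
  by apply/funext => x; rewrite E; case: (propagator x H j i).
have -> : (fun x => Im (propagator (- x) H i j)) = (fun x => - Im (propagator x H j i)).
  by apply/funext => x; rewrite E; case: (propagator x H j i).
have -> : (- ('i%C *: (propagator (- s) H *m H))) i j =
    (('i%C *: (H *m propagator s H)) j i)^*.
  rewrite -adjmxE; congr (_ i j); rewrite adjmxZ trmx_mul map_mxM.
  rewrite (hermitian_adj hH) -propagatorN -scaleNr.
  have -> // : ('i%C : C)^* = - 'i%C.
  by apply/eqP; rewrite eq_complex /= oppr0 !eqxx.
split; first by apply: is_derive_eq h1 _; case: (_ j i).
by apply: is_derive_eq (is_deriveN h2) _; case: (_ j i).
Qed.

(** * The interaction picture *)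

Lemma liouvillian_HE H S : liouvillian_H H S = - ('i%C *: (H *m S)) + 'i%C *: (S *m H).
Proof. by rewrite /liouvillian_H /commutator scalerBr !scaleNr opprK. Qed.

Definition interaction H (F : R -> 'M[C]_n) s :=
  propagator s H *m F s *m propagator (- s) H.

Lemma mderive_interaction H (F : R -> 'M[C]_n) s D : H \is hermsymmx ->
  mderive F s (liouvillian_H H (F s) + D) ->
  mderive (interaction H F) s (propagator s H *m D *m propagator (- s) H).
Proof.
move=> hH hF.
apply: mderive_eq (mderiveM (mderiveM (mderive_propagator s hH) hF)
  (mderive_propagatorN s hH)) _.
(* Commuting [H] past the two propagators puts it next to [F s], so the outer terms of the Leibniz
   rule become [i U H (F s) V] and [- i U (F s) H V], which cancel the conjugated commutator. *)
rewrite liouvillian_HE -(propagator_comm s hH) (propagator_comm (- s) hH).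
move: (propagator s H) (propagator (- s) H) => U V.
rewrite !mulmxDr !mulmxDl mulmxN !mulmxN mulNmx -!scalemxAr -!scalemxAl -?scalemxAr
  -?scalemxAl !mulmxA.
by rewrite -!addrA addNKr addrC subrK.
Qed.

(** * From difference quotients on the half-line to two-sided derivatives *)

(** Coordinates, [Re] and [Im] are continuous and commute with scaling by the real [h^-1], so the
    limit of the complex quotient passes to each real component. *)
Lemma cvg_mderive (F : R -> 'M[C]_n) s (D : 'M[C]_n) :
  ((h^-1)%:C%C *: (F (s + h) - F s) @[h --> (0 : R)^'] --> D) -> mderive F s D.
Proof.
move=> hF i j.
have hij : (((h^-1)%:C%C *: (F (s + h) - F s)) i j) @[h --> (0 : R)^'] --> D i j.
  exact: (cvg_comp _ _ hF (@coord_continuous C n n i j D)).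
split.
  have hc : (fun h => h^-1 *: (((fun x => Re (F x i j)) \o shift s) (h *: 1)
      - Re (F s i j))) @ (0 : R)^' --> Re (D i j).
    have -> : (fun h => h^-1 *: (((fun x => Re (F x i j)) \o shift s) (h *: 1)
        - Re (F s i j))) =
       (fun h : R => Re (((h^-1)%:C%C *: (F (s + h) - F s)) i j)).
      apply/funext => h; rewrite mxE complex_Re_realM !mxE complex_ReD complex_ReN /=.
      by rewrite [h *: 1]mulr1 [h + s]addrC.
    exact: (cvg_comp _ _ hij (@Re_continuous _ _)).
  by apply: DeriveDef; [apply/cvg_ex; exists (Re (D i j))|exact: cvg_lim hc].
have hc : (fun h => h^-1 *: (((fun x => Im (F x i j)) \o shift s) (h *: 1)
    - Im (F s i j))) @ (0 : R)^' --> Im (D i j).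
  have -> : (fun h => h^-1 *: (((fun x => Im (F x i j)) \o shift s) (h *: 1)
      - Im (F s i j))) =
     (fun h : R => Im (((h^-1)%:C%C *: (F (s + h) - F s)) i j)).
    apply/funext => h;
      rewrite mxE complex_ImM /= mul0r addr0 !mxE complex_ImD complex_ImN /=.
    by rewrite [h *: 1]mulr1 [h + s]addrC.
  exact: (cvg_comp _ _ hij (@Im_continuous _ _)).
by apply: DeriveDef; [apply/cvg_ex; exists (Im (D i j))|exact: cvg_lim hc].
Qed.

(* Continuing a solution on [0, +oo[ by its tangent at 0 makes the derivative at 0
   two-sided, whence the continuity at 0 that the mean value theorem on [0, t] needs. *)
Definition linear_extension (F : R -> 'M[C]_n) (D : 'M[C]_n) s :=
  if 0 <= s then F s else F 0 + s%:C%C *: D.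

Lemma mderive_linear_extension (L : 'M[C]_n -> 'M[C]_n) F s :
  solves_on_nonneg L F -> 0 <= s ->
  mderive (linear_extension F (L (F 0))) s (L (F s)).
Proof.
move=> hF s0; apply: cvg_mderive => A hA.
have hin : \forall h \near (0 : R)^', 0 <= s + h ->
    A ((h^-1)%:C%C *: (F (s + h) - F s)).
  exact: hF s s0 A hA.
(* The condition [0 < s] stays inside the statement, so that it can be used before distinguishing
   [s > 0] from [s = 0]. *)
have hs : \forall h \near (0 : R)^', 0 < s -> `|h| < s.
  have [s1|_] := boolP (0 < s); last by apply: filterE => h.
  by apply: filterS (dnbhs0_lt s1) => h hs _.
have hn : \forall h \near (0 : R)^', h != 0 by exact: nbhs_dnbhs_neq.
set G := linear_extension F (L (F 0)).
change (\forall h \near (0 : R)^', A ((h^-1)%:C%C *: (G (s + h) - G s))).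
rewrite /G; near=> h.
have h0 : h != 0 by near: h; exact: hn.
rewrite /linear_extension s0; case: ifPn => [sh|].
  by move: sh; near: h.
rewrite -ltNge => sh.
have hlt : 0 < s -> `|h| < s by near: h.
(* For [s > 0] the increment is smaller than [s], so [s + h < 0] can only occur at [s = 0]. *)
have sE : s = 0.
  apply/eqP; rewrite eq_le s0 andbT leNgt; apply/negP => /hlt.
  by rewrite ltr_norml => /andP[+ _]; lra.
move: sh; rewrite sE add0r => sh.
(* On the tangent branch the quotient equals [L (F 0)] exactly, which lies in every neighbourhood of
   itself. *)
rewrite [F 0 + _]addrC addrK scalerA -rmorphM mulVf // rmorph1 scale1r -sE.
exact: nbhs_singleton hA.
Unshelve. all: by end_near. Qed.

(** * The trace distance estimate *)

Lemma trace_distance_evolution H G (rho : R -> 'M[C]_n) (t : R) :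
  H \is hermsymmx -> G \is hermsymmx ->
  solves_on_nonneg (fun S => liouvillian_H H S + liouvillian_G G S) rho ->
  (forall s : R, 0 <= s -> trace_norm (rho s) <= 1) -> 0 <= t ->
  trace_distance (rho t) (unitary_evolution t H (rho 0)) <= operator_norm G * t.
Proof.
move=> hH hG hrho hnorm t0.
set F := linear_extension rho (liouvillian_H H (rho 0) + liouvillian_G G (rho 0)).
have FE (s : R) : 0 <= s -> F s = rho s by rewrite /F /linear_extension => ->.
pose sigma := interaction H F.
have dsigma (s : R) : 0 <= s -> mderive sigma s
    (propagator s H *m liouvillian_G G (rho s) *m propagator (- s) H).
  by move=> s0; apply: mderive_interaction => //; rewrite FE //;
    exact: mderive_linear_extension hrho s0.
have bound : trace_norm (sigma t - sigma 0) <= 2 * operator_norm G * t.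
  apply: trace_norm_le => W hW; rewrite trace_pairingDr trace_pairingNr.
  have dphi (s : R) : 0 <= s -> is_derive s (1 : R) (fun x => trace_pairing W (sigma x))
      (trace_pairing W
        (propagator s H *m liouvillian_G G (rho s) *m propagator (- s) H)).
    by move=> s0; apply: mderive_trace_pairing; exact: dsigma.
  (* The contraction [W] is fixed before the mean value theorem is applied, so the intermediate
     point [c] may depend on [W]; the bound on the derivative is uniform in both. *)
  have [||c] := MVT_segment t0 (f := fun x => trace_pairing W (sigma x))
     (df := fun s =>
       trace_pairing W
         (propagator s H *m liouvillian_G G (rho s) *m propagator (- s) H)).
  - by move=> x; rewrite in_itv /= => /andP[/ltW x0 _]; exact: dphi.
  - apply: derivable_within_continuous => x; rewrite in_itv /= => /andP[x0 _].
    by have [] := dphi x x0.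
  rewrite in_itv /= => /andP[c0 _] ->; rewrite subr0; apply: ler_wpM2r => //.
  (* The derivative at [c] is at most the trace norm of the conjugated [liouvillian_G G (rho c)],
     hence at most [2 * operator_norm G * trace_norm (rho c)], and [trace_norm (rho c) <= 1]. *)
  apply: le_trans (trace_pairing_le_trace_norm _ ler01 hW) _; rewrite mul1r.
  apply: le_trans
    (trace_norm_unitary _ (propagator_unitary _ _) (propagator_unitary _ _)) _.
  apply: le_trans (trace_norm_liouvillian_G _ hG) _.
  by rewrite ler_piMr ?hnorm // mulr_ge0 // operator_norm_ge0.
(* The factor [2^-1] of the trace distance absorbs the 2 of the anticommutator bound. *)
rewrite /trace_distance ler_pdivrMl // mulrA; apply: le_trans bound.
(* Undoing the conjugation at time [t] sends [sigma t] to [rho t], and [sigma 0 = rho 0] to its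
   unitary evolution. *)
have -> : rho t - unitary_evolution t H (rho 0) =
  propagator (- t) H *m (sigma t - sigma 0) *m propagator t H.
  rewrite unitary_evolutionE // mulmxBr mulmxBl /sigma /interaction !FE //
    oppr0 propagator0 mul1mx mulmx1.
  have : propagator (- t) H *m propagator t H = 1%:M.
    by rewrite propagatorN unitarymxKt // propagator_unitary.
  move: (propagator t H) (propagator (- t) H) => U V VU.
  by rewrite !mulmxA VU mul1mx -[_ *m V *m U]mulmxA VU mulmx1.
exact: trace_norm_unitary (propagator_unitary _ _) (propagator_unitary _ _).
Qed.

End Propagator.

Theorem mainTheorem4 (R : realType) (n : nat) (H Gamma : 'M[R[i]]_n)
    (rho : R -> 'M[R[i]]_n)
    (hH : H \is hermsymmx) (hGamma : Gamma \is hermsymmx)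
    (hrho : solves_on_nonneg
              (fun S => liouvillian_H H S + liouvillian_G Gamma S) rho)
    (hrho0 : is_density (rho 0))
    (hnorm : forall s : R, 0 <= s -> trace_norm (rho s) <= 1) :
  (norm_1to1 (liouvillian_G Gamma) <= (2 * operator_norm Gamma)%:E)%E /\
  (forall t : R, 0 <= t ->
     trace_distance (rho t) (unitary_evolution t H (rho 0))
       <= operator_norm Gamma * t).
Proof.
split; first exact: norm_1to1_liouvillian_G.
by move=> t t0; exact: trace_distance_evolution hH hGamma hrho hnorm t0.
Qed.
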